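(* Let $m$ be a positive integer and let $\alpha=(\alpha_{k+m})_{k\in\mathbb N}$ be a sequence of commuting indeterminates. The production matrix of the generalised $m$-Stieltjes-Rogers polynomials $\left(S^{(m)}_{n_0,n_1}(\alpha)\right)_{n_0,n_1\in\mathbb N}$ is the $(m+2)$-banded unit-lower-Hessenberg matrix $\mathrm H^{(m)}=\left(h^{(m)}_{i,n}(\alpha)\right)_{i,n\in\mathbb N}$ whose entries are $h^{(m)}_{i,n}(\alpha)=0$ if $i\leq n-2$ or $i\geq n+m+1$, $h^{(m)}_{n-1,n}(\alpha)=1$ for all $n\geq 1$, and, setting $\alpha_j=0$ for $0\leq j\leq m-1$, $$h^{(m)}_{n+k,n}(\alpha)=\sum_{m\geq\ell_0>\cdots>\ell_k\geq 0}\ \prod_{j=0}^{k}\alpha_{(m+1)(n+j)+\ell_j}\qquad\text{for all }n\in\mathbb N\text{ and }0\leq k\leq m.$$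
   Context: $\mathbb N=\{0,1,2,\dots\}$. A partial $m$-Dyck path is a finite path in $\mathbb N\times\mathbb N$ using steps $(1,1)$ (rises) and $(1,-m)$ ($m$-falls), allowed to start and end anywhere in $\mathbb N\times\mathbb N$. Each rise gets weight $1$ and each $m$-fall from height $i$ gets weight $\alpha_i$; the weight of a path is the product of the weights of its steps. The generalised $m$-Stieltjes-Rogers polynomial $S^{(m)}_{n,k}(\alpha)$ is the sum of the weights of all partial $m$-Dyck paths from $(0,0)$ to $((m+1)n,(m+1)k)$; these form an infinite unit-lower-triangular matrix. An infinite matrix $\mathrm H=(h_{i,n})_{i,n\in\mathbb N}$ is unit-lower-Hessenberg if $h_{i,n}=0$ for $n\ge i+2$ and $h_{i,i+1}=1$ for all $i$. For a row-finite infinite matrix $\Pi=(\pi_{i,j})_{i,j\in\mathbb N}$ over a commutative ring, the output matrix of $\Pi$ is $A=(a_{n,k})_{n,k\in\mathbb N}$ with $a_{n,k}=(\Pi^n)_{0,k}$, and $\Pi$ is called the production matrix of $A$. Every unit-lower-triangular infinite matrix has a unique production matrix, which is unit-lower-Hessenberg. *)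

(* Defs.v *)
From HB Require Import structures.
From mathcomp Require Import all_boot all_order all_algebra.
From mathcomp Require Import classical_sets cardinality fsbigop.

Set Implicit Arguments.
Unset Strict Implicit.
Unset Printing Implicit Defensive.

Import GRing.Theory.
Local Open Scope ring_scope.
Local Open Scope classical_set_scope.

(* A path is given by its starting height and its word of steps, [true] for a
   rise (1,1) and [false] for an m-fall (1,-m).  As every step has horizontal
   extent 1, a path from (0, h) whose word is w ends at abscissa [size w].
   [dyck_path m h w h'] says that the path never leaves N x N and ends at
   height h'. *)
Fixpoint dyck_path (m h : nat) (w : seq bool) (h' : nat) : bool :=
  match w with
  | [::] => h == h'
  | true :: w1 => dyck_path m h.+1 w1 h'
  | false :: w1 => (m <= h)%N && dyck_path m (h - m)%N w1 h'
  end.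

Fixpoint dyck_weight (R : comNzRingType) (m : nat) (alpha : nat -> R)
    (h : nat) (w : seq bool) : R :=
  match w with
  | [::] => 1
  | true :: w1 => dyck_weight m alpha h.+1 w1
  | false :: w1 => alpha h * dyck_weight m alpha (h - m)%N w1
  end.

(* Only the values of alpha at indices >= m occur in the weights. *)
Definition stieltjes_rogers (R : comNzRingType) (m : nat) (alpha : nat -> R)
    (n k : nat) : R :=
  \sum_(w : (m.+1 * n)%N.-tuple bool | dyck_path m 0%N w (m.+1 * k)%N)
     dyck_weight m alpha 0%N w.

Definition infmx (R : comNzRingType) := nat -> nat -> R.

Definition row_finite (R : comNzRingType) (P : infmx R) : Prop :=
  forall i, finite_set [set j | P i j <> 0].

Definition infmx_one (R : comNzRingType) : infmx R :=
  fun i j => (i == j)%:R.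

(* The sum over [set: nat] is the sum of a finitely supported family; the
   support is finite whenever A is row-finite. *)
Definition infmx_mul (R : comNzRingType) (A B : infmx R) : infmx R :=
  fun i k => \sum_(j \in [set: nat]) (A i j * B j k).

Fixpoint infmx_exp (R : comNzRingType) (P : infmx R) (n : nat) : infmx R :=
  match n with
  | 0 => infmx_one R
  | n1.+1 => infmx_mul (infmx_exp P n1) P
  end.

Definition output_matrix (R : comNzRingType) (P : infmx R) : infmx R :=
  fun n k => infmx_exp P n 0%N k.

Definition is_production_matrix (R : comNzRingType) (P A : infmx R) : Prop :=
  row_finite P /\ output_matrix P =2 A.

Definition unit_lower_hessenberg (R : comNzRingType) (H : infmx R) : Prop :=
  (forall i n, (i.+2 <= n)%N -> H i n = 0) /\ (forall i, H i i.+1 = 1).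

(* For a lower-Hessenberg matrix this leaves r nonzero diagonals: the
   superdiagonal, the main diagonal and the first r - 2 subdiagonals. *)
Definition hessenberg_banded (R : comNzRingType) (r : nat) (H : infmx R) :
    Prop :=
  forall i n, (n + r <= i.+1)%N -> H i n = 0.

Definition alpha_ext (R : comNzRingType) (m : nat) (alpha : nat -> R)
    (j : nat) : R :=
  if (j < m)%N then 0 else alpha j.

(* The entry in row n + k and column n, for k <= m; the tuple l lists
   l_0 > ... > l_k. *)
Definition hess_coef (R : comNzRingType) (m : nat) (alpha : nat -> R)
    (n k : nat) : R :=
  \sum_(l : k.+1.-tuple 'I_m.+1 | sorted (fun a b : 'I_m.+1 => (b < a)%N) l)
     \prod_(j < k.+1) alpha_ext m alpha (m.+1 * (n + j) + tnth l j)%N.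

Definition hess_mx (R : comNzRingType) (m : nat) (alpha : nat -> R) : infmx R :=
  fun i n =>
    if i.+1 == n then 1
    else if (n <= i <= n + m)%N then hess_coef m alpha n (i - n)
    else 0.

(* Main.v *)
Require Import Defs.
From HB Require Import structures.
From mathcomp Require Import all_boot all_order all_algebra.
From mathcomp Require Import classical_sets cardinality fsbigop.
From mathcomp Require Import zify.

Set Implicit Arguments.
Unset Strict Implicit.
Unset Printing Implicit Defensive.

Import GRing.Theory.
Local Open Scope ring_scope.

(** Both sides count paths: cutting a path from (0,0) to ((m+1)(n+1),(m+1)k)
    at abscissa (m+1)n gives S(n+1,k) = sum_j S(n,j) H(j,k), where H(j,k) is the
    weighted count of paths with m+1 steps from height (m+1)j to height (m+1)k.
    Such a path is determined by the times l_k < ... < l_0 at which it falls, and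
    the fall at time l_j starts from height (m+1)(n+j) + l_j; this identifies H
    with the explicit Hessenberg matrix.  Uniqueness holds because S is
    unit-lower-triangular, so the rows of a production matrix are determined one
    after the other. *)

Lemma big_tuple_cons (V : nmodType) (T : finType) n (P : pred (seq T))
    (F : seq T -> V) :
  \sum_(w : n.+1.-tuple T | P w) F w =
  \sum_(x : T) \sum_(w : n.-tuple T | P (x :: w)) F (x :: w).
Proof.
rewrite pair_big_dep /=.
rewrite (reindex (fun p : T * n.-tuple T => [tuple of p.1 :: p.2])) //=.
apply/onW_bij/inj_card_bij; last by rewrite card_prod !card_tuple expnS.
move=> [x s] [y t] /(congr1 val) /= [-> st]; congr pair; exact: val_inj.
Qed.

Lemma big_tuple_rcons (V : nmodType) (T : finType) n (P : pred (seq T))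
    (F : seq T -> V) :
  \sum_(w : n.+1.-tuple T | P w) F w =
  \sum_(x : T) \sum_(w : n.-tuple T | P (rcons w x)) F (rcons w x).
Proof.
rewrite pair_big_dep /=.
rewrite (reindex (fun p : T * n.-tuple T => [tuple of rcons p.2 p.1])) //=.
apply/onW_bij/inj_card_bij; last by rewrite card_prod !card_tuple expnS.
by move=> [x s] [y t] /(congr1 val) /= /rcons_inj[] /val_inj-> ->.
Qed.

(** Restricts a sum over the intermediate heights at a cut to the multiples of m + 1. *)
Lemma big_ord_mul_dvdn (V : nmodType) d n (G : nat -> V) :
  (forall i, ~~ (d.+1 %| i)%N -> G i = 0) ->
  \sum_(i < n * d.+1) G i = \sum_(j < n) G (d.+1 * j)%N.
Proof.
move=> G0; rewrite -(big_mkord xpredT G) big_nat_mul big_mkord.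
apply: eq_bigr => j _; rewrite big_ltn ?ltn_mul2r //= mulnC.
rewrite big_nat_cond big1 ?addr0 // => i; rewrite andbT => /andP[lo hi].
apply: G0; apply/negP => /dvdnP[q eq_i]; move: lo hi.
rewrite eq_i (mulnC d.+1) !ltn_mul2r /=; lia.
Qed.

Section Paths.

Variables (R : comNzRingType) (m : nat) (alpha : nat -> R).

Local Notation a := (alpha_ext m alpha).

(** No test m <= h is made: a fall from below m has weight [a h = 0], which also neutralises the
    truncated [h - m]. *)
Fixpoint path_sum (N h h' : nat) : R :=
  if N is N1.+1 then path_sum N1 h.+1 h' + a h * path_sum N1 (h - m) h'
  else (h == h')%:R.

Lemma path_sumE N h h' :
  \sum_(w : N.-tuple bool | dyck_path m h w h') dyck_weight m alpha h w
  = path_sum N h h'.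
Proof.
elim: N h => [|N IH] h /=.
  rewrite big_mkcond (big_pred1 [tuple]) /=; last by move=> w; exact/esym/eqP/tuple0.
  by case: eqP.
rewrite (big_tuple_cons N (fun w => dyck_path m h w h') (dyck_weight m alpha h)).
rewrite big_bool /= IH -IH -mulr_sumr /alpha_ext ltnNge.
by case: (m <= h)%N => /=; rewrite ?IH // big_pred0_eq mulr0 mul0r.
Qed.

Lemma stieltjes_rogersE n k :
  stieltjes_rogers m alpha n k = path_sum (m.+1 * n) 0 (m.+1 * k).
Proof. exact: path_sumE. Qed.

Lemma path_sum_out N h h' : (h + N < h')%N -> path_sum N h h' = 0.
Proof.
elim: N h => [|N IH] h /= lt_h; first by case: eqP => //; lia.
by rewrite !IH ?mulr0 ?addr0 //; lia.
Qed.

Lemma path_sum_top N h : (0 < m)%N -> path_sum N h (h + N) = 1.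
Proof.
move=> m_gt0; elim: N h => [|N IH] h /=; first by rewrite addn0 eqxx.
by rewrite addnS -addSn IH path_sum_out ?mulr0 ?addr0 //; lia.
Qed.

(** Since -m = 1 modulo m + 1, a rise and a fall change the height by the same residue. *)
Lemma path_sum_mod N h h' :
  h + N != h' %[mod m.+1] -> path_sum N h h' = 0.
Proof.
elim: N h => [|N IH] h /=.
  by rewrite addn0; case: (eqVneq h h') => [->|] //; rewrite eqxx.
move=> neq; rewrite IH ?add0r; last by rewrite addSnnS.
rewrite /alpha_ext; case: ltnP => [_|le_mh]; first by rewrite mul0r.
rewrite IH ?mulr0 //; apply: contraNneq neq => <-.
by apply/eqP; rewrite -(modnDr (h - m + N)); congr modn; lia.
Qed.

(** Any [B] beyond the reachable heights is allowed, so one [B] serves both branches of the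
    induction. *)
Lemma path_sum_cat B M N h h' : (h + M < B)%N ->
  path_sum (M + N) h h' = \sum_(i < B) path_sum M h i * path_sum N i h'.
Proof.
elim: M h => [|M IH] h /= ltB.
  rewrite addn0 in ltB; rewrite (bigD1 (Ordinal ltB)) //= eqxx mul1r big1 ?addr0 //.
  by move=> i; rewrite -val_eqE /= eq_sym => /negPf ->; rewrite mul0r.
rewrite !IH; try lia; rewrite mulr_sumr -big_split /=.
by apply: eq_bigr => i _; rewrite mulrDl mulrA.
Qed.

(* The sum defining [hess_coef], over k entries (not k + 1) all at least t. *)
Definition fall_sum n k t : R :=
  \sum_(l : k.-tuple 'I_m.+1
        | sorted (fun b c : 'I_m.+1 => (c < b)%N) l
          && all (fun b : 'I_m.+1 => (t <= b)%N) l)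
     \prod_(j < k) a (m.+1 * (n + j) + tnth l j)%N.

Lemma hess_coefE n k : hess_coef m alpha n k = fall_sum n k.+1 0.
Proof.
by apply: eq_bigl => l; rewrite (eq_all (a2 := xpredT)) // all_predT andbT.
Qed.

Lemma fall_sum0 n t : fall_sum n 0 t = 1.
Proof.
rewrite /fall_sum (big_pred1 [tuple]) ?big_ord0 // => l.
by rewrite tuple0; apply/esym/eqP.
Qed.

Lemma fall_sum_rcons n k t :
  fall_sum n k.+1 t =
  \sum_(x < m.+1 | (t <= x)%N) a (m.+1 * (n + k) + x)%N * fall_sum n k x.+1.
Proof.
pose gto := fun b c : 'I_m.+1 => (c < b)%N.
have gto_trans : transitive gto by move=> y x z; rewrite /gto; lia.
pose P t (s : seq 'I_m.+1) := sorted gto s && all (fun b : 'I_m.+1 => (t <= b)%N) s.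
(* With [nth] the summand depends on the underlying sequence only, as [big_tuple_rcons] requires. *)
have FE j r : fall_sum n j r = \sum_(l : j.-tuple 'I_m.+1 | P r l)
    \prod_(i < j) a (m.+1 * (n + i) + nth ord0 l i)%N.
  by apply: eq_bigr => l _; apply: eq_bigr => i _; rewrite (tnth_nth ord0).
rewrite FE (big_tuple_rcons k (P t)
  (fun l => \prod_(i < k.+1) a (m.+1 * (n + i) + nth ord0 l i)%N)).
rewrite [RHS]big_mkcond; apply: eq_bigr => x _.
have PE (w : k.-tuple 'I_m.+1) : P t (rcons w x) = (t <= x)%N && P x.+1 w.
  rewrite /P !sorted_pairwise // pairwise_rcons all_rcons -/gto.
  case: (leqP t x) => le_tx; rewrite ?andbF //= [RHS]andbC.
  case: (boolP (all _ w)) => //= /allP gt_x; rewrite -[RHS]andbT; congr andb.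
  by apply/allP => y /gt_x /=; rewrite /gto; lia.
under eq_bigl do rewrite PE.
case: leqP => //= _; last by rewrite big_pred0_eq.
rewrite FE mulr_sumr; apply: eq_bigr => w _.
rewrite big_ord_recr /= mulrC nth_rcons size_tuple ltnn eqxx; congr (_ * _).
by apply: eq_bigr => i _; rewrite nth_rcons size_tuple ltn_ord.
Qed.

(** Pigeonhole: the k entries are distinct and lie between t and m. *)
Lemma fall_sum_out n k t : (m.+1 < k + t)%N -> (t <= m.+1)%N -> fall_sum n k t = 0.
Proof.
elim: k t => [|k IH] t lt_mk le_t; first by lia.
rewrite fall_sum_rcons big1 // => x le_tx.
by rewrite IH ?mulr0 //; have := ltn_ord x; lia.
Qed.

(** Either t is not an entry, or it is the last one. This matches the choice between a rise and a
    fall in [path_sum]. *)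
Lemma fall_sumS n k t : (t <= m)%N ->
  fall_sum n k.+1 t =
  fall_sum n k.+1 t.+1 + a (m.+1 * (n + k) + t)%N * fall_sum n k t.+1.
Proof.
move=> le_tm; rewrite !fall_sum_rcons.
have lt_tm : (t < m.+1)%N by [].
rewrite (bigD1 (Ordinal lt_tm)) //= addrC; congr (_ + _).
by apply: eq_bigl => x; rewrite -val_eqE /=; lia.
Qed.

(* [N] steps remain out of a block of [m + 1]: the current height is
   (m+1)(p-1) + (m+1-N), and p - n falls lie ahead. *)
Lemma path_sum_fall N h p n t :
  (N + t = m.+1)%N -> (h + m.+1 = m.+1 * p + t)%N ->
  path_sum N h (m.+1 * n) = if (p < n)%N then 0 else fall_sum n (p - n) t.
Proof.
elim: N h p t => [|N IH] h p t Nt hp /=.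
  have -> : h = (m.+1 * p)%N by lia.
  rewrite eqn_mul2l /=; case: ltngtP => [||->].
  - by [].
  - by move=> lt_np; rewrite fall_sum_out //; lia.
  - by rewrite subnn fall_sum0.
rewrite (IH _ p t.+1); try lia.
case: p hp => [|p] hp; first by lia.
(* A fall lowers p by one and raises t by one; if h < m, both sides vanish through [a h]. *)
have -> : a h * path_sum N (h - m) (m.+1 * n) =
          a h * (if (p < n)%N then 0 else fall_sum n (p - n) t.+1).
  rewrite /alpha_ext; case: ltnP => [_|le_mh]; first by rewrite !mul0r.
  by rewrite (IH _ p t.+1) //; lia.
case: (ltngtP n p.+1) => [lt_np||->].
- rewrite ltnS in lt_np; rewrite subSn // [RHS]fall_sumS; last by lia.
  (* The height before the fall is h = (m+1)p + t, the index given by [fall_sumS]. *)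
  by rewrite subnKC //; congr (_ + a _ * _); lia.
- by move=> _; rewrite mulr0 addr0.
- by rewrite subnn !fall_sum0 mulr0 addr0.
Qed.

Lemma hess_mxE i n :
  hess_mx m alpha i n = path_sum m.+1 (m.+1 * i) (m.+1 * n).
Proof.
(* A full block has t = 0, hence p = i + 1: there are i + 1 - n falls, none of them on the
   superdiagonal. *)
rewrite (@path_sum_fall _ _ i.+1 n 0); try lia.
rewrite /hess_mx; case: (ltngtP n i.+1) => [lt_ni|lt_in|->].
- rewrite ltnS in lt_ni; rewrite lt_ni /= hess_coefE subSn //.
  by case: leqP => // lt_nmi; rewrite fall_sum_out //; lia.
- by rewrite leqNgt (ltnW lt_in).
- by rewrite subnn fall_sum0.
Qed.

Lemma stieltjes_rogers0 k : stieltjes_rogers m alpha 0 k = (0 == k)%:R.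
Proof. by rewrite stieltjes_rogersE muln0 /= -[0%N in LHS](muln0 m.+1) eqn_mul2l. Qed.

Lemma stieltjes_rogers_upper n k :
  (n < k)%N -> stieltjes_rogers m alpha n k = 0.
Proof.
by move=> lt_nk; rewrite stieltjes_rogersE path_sum_out // add0n ltn_mul2l.
Qed.

Lemma stieltjes_rogers_diag n : (0 < m)%N -> stieltjes_rogers m alpha n n = 1.
Proof. by move=> m_gt0; rewrite stieltjes_rogersE -[X in path_sum _ _ X]add0n path_sum_top. Qed.

Lemma stieltjes_rogersS n k :
  stieltjes_rogers m alpha n.+1 k =
  \sum_(j < n.+1) stieltjes_rogers m alpha n j * hess_mx m alpha j k.
Proof.
(* The bound (n+1)(m+1) exceeds every height reachable in (m+1)n steps and is a multiple of m +
   1. *)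
rewrite stieltjes_rogersE mulnS addnC (@path_sum_cat (n.+1 * m.+1)); last by lia.
rewrite (big_ord_mul_dvdn n.+1 (G := fun i =>
  path_sum (m.+1 * n) 0 i * path_sum m.+1 i (m.+1 * k))).
  by apply: eq_bigr => j _; rewrite stieltjes_rogersE hess_mxE.
by move=> i ndvd; rewrite path_sum_mod ?mul0r // add0n modnMr eq_sym.
Qed.

(** Row n of the Stieltjes-Rogers matrix is supported on j <= n, so the sum is finite for every [P].
    This serves both existence and uniqueness. *)
Lemma infmx_mul_stieltjes_rogers (A P : infmx R) n k :
  (forall j, A 0%N j = stieltjes_rogers m alpha n j) ->
  infmx_mul A P 0%N k = \sum_(j < n.+1) stieltjes_rogers m alpha n j * P j k.
Proof.
move=> AE; rewrite (fsbig_ord _ n.+1 (fun j => stieltjes_rogers m alpha n j * P j k)).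
rewrite /infmx_mul [LHS](eq_fsbigr (fun j => stieltjes_rogers m alpha n j * P j k)).
  2: by move=> j _; rewrite AE.
apply/esym/fsbig_widen => // j [_ /=] /negP; rewrite -leqNgt => lt_nj.
by rewrite stieltjes_rogers_upper ?mul0r.
Qed.

End Paths.

Theorem proposition3p5 (R : comNzRingType) (m : nat) (hm : (0 < m)%N)
    (alpha : nat -> R) :
  [/\ unit_lower_hessenberg (hess_mx m alpha),
      hessenberg_banded m.+2 (hess_mx m alpha),
      is_production_matrix (hess_mx m alpha) (stieltjes_rogers m alpha)
    & forall P : infmx R,
        is_production_matrix P (stieltjes_rogers m alpha) ->
        P =2 hess_mx m alpha].
Proof.
have upper i n : (i.+2 <= n)%N -> hess_mx m alpha i n = 0.
  by move=> lt_in; rewrite /hess_mx; case: ifP => [|_]; [lia | case: ifP => //; lia].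
split.
- by split=> // i; rewrite /hess_mx eqxx.
- by move=> i n le_ni; rewrite /hess_mx; case: ifP => [|_]; [lia | case: ifP => //; lia].
- split=> [i|n].
    apply: sub_finite_set (finite_II i.+2) => j /= Hij.
    by rewrite ltnNge; apply/negP => /upper.
  elim: n => [|n IH] k; first by rewrite stieltjes_rogers0.
  by rewrite stieltjes_rogersS; apply: infmx_mul_stieltjes_rogers IH.
- move=> P [_ outP]; elim/ltn_ind => n IH k.
  have := outP n.+1 k.
  rewrite /output_matrix /= (@infmx_mul_stieltjes_rogers _ m alpha _ _ n); last exact: outP.
  (* The unit diagonal isolates row n as the last summand on each side; the earlier rows agree by
     induction and cancel. *)
  rewrite stieltjes_rogersS !big_ord_recr /= stieltjes_rogers_diag // !mul1r.
  under eq_bigr => j _ do rewrite IH //.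
  exact: addrI.
Qed.
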